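(* Let $n\geq 2$ and $p\in(1,\infty)\setminus\{2\}$. Then there exist a convex and compact set $\Omega\subset\mathbb{R}^n$ (of positive Lebesgue measure), two distinct points $x_1,x_2\in\Omega$, and $0<\lambda<1$ such that the cell $T^{-1}(x_1)$ is not connected, where $T$ is the optimal transportation map from the normalised Lebesgue measure $\mu$ on $\Omega$ to $\nu=\lambda\delta_{x_1}+(1-\lambda)\delta_{x_2}$ for the cost function $c_p(x,y)=\frac1p|x-y|^p$.
   Context: For a compact set $\Omega\subset\mathbb{R}^n$ of positive Lebesgue measure, $\mu$ is Lebesgue measure restricted to $\Omega$ and normalised to total mass $1$. A transportation map from $\mu$ to $\nu$ is a Borel map pushing $\mu$ forward to $\nu$; it is optimal for the cost $c_p$ if it minimises $\int_\Omega c_p(x,\tilde T(x))\,d\mu(x)$ among all transportation maps $\tilde T$ from $\mu$ to $\nu$. The optimal transportation map is only determined $\mu$-a.e.; it is represented as follows. There are constants $b_1,b_2\in\mathbb{R}$ such that, with $\Phi_i(z)=-\frac1p|x_i-z|^p+b_i$ for $i=1,2$, one has $T(z)=x_1$ when $\Phi_1(z)>\Phi_2(z)$ and $T(z)=x_2$ when $\Phi_2(z)>\Phi_1(z)$, the set $\{\Phi_1=\Phi_2\}$ being $\mu$-null. The constants satisfy $\mu(\{\Phi_1>\Phi_2\})=\lambda$ and $\mu(\{\Phi_2>\Phi_1\})=1-\lambda$. The cell of $x_1$ is by definition the relatively open set $$T^{-1}(x_1)=\{q\in\Omega:\ \Phi_1(q)>\Phi_2(q)\}.$$ Connectedness refers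 to the subspace topology. *)

(* Defs.v *)
From HB Require Import structures.
From mathcomp Require Import all_boot all_order all_algebra.
From mathcomp Require Import all_classical all_reals all_analysis.
From mathcomp Require Import measurable_realfun.

Set Implicit Arguments.
Unset Strict Implicit.
Unset Printing Implicit Defensive.

Import Order.TTheory GRing.Theory Num.Theory.
Import numFieldNormedType.Exports.

Local Open Scope classical_set_scope.
Local Open Scope ring_scope.

Definition borel_mx_display : measure_display. Proof. exact. Qed.

Section borel_mx.
Context {R : realType} (m n : nat).
Let B : set (set 'M[R]_(m, n)) := <<s open >>.
Let B0 : B set0. Proof. exact: sigma_algebra0. Qed.
Let BC A : B A -> B (~` A). Proof. exact: sigma_algebraC. Qed.
Let BU (F : (set 'M[R]_(m, n))^nat) : (forall i, B (F i)) -> B (\bigcup_i F i).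
Proof. exact: sigma_algebra_bigcup. Qed.

(* The Borel sigma-algebra: the one generated by the open sets. *)
HB.instance Definition _ :=
  @isMeasurable.Build borel_mx_display 'M[R]_(m, n) B B0 BC BU.
End borel_mx.

Section borel_rV.
Context {R : realType}.

Lemma open_measurable_mx m n (U : set 'M[R]_(m, n)) : open U -> measurable U.
Proof. exact: sub_sigma_algebra. Qed.

Lemma closed_measurable_mx m n (F : set 'M[R]_(m, n)) :
  closed F -> measurable F.
Proof.
by move=> cF; rewrite -(setCK F); apply: measurableC; apply: open_measurable_mx;
  exact: closed_openC.
Qed.

Lemma compact_measurable_mx m n (K : set 'M[R]_(m, n)) :
  compact K -> measurable K.
Proof.
move=> cK; apply: closed_measurable_mx.
by apply: compact_closed => //; exact: norm_hausdorff.
Qed.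

Lemma measurable_coord n (i : 'I_n) :
  measurable_fun [set: 'rV[R]_n] (fun x => x ord0 i : measurableTypeR R).
Proof.
apply: (measurability _ (RGenOpens.measurableE R)) => _ [_ [a [b ->]] <-].
rewrite setTI; apply: open_measurable_mx.
by apply: open_comp => // x _; exact: coord_continuous.
Qed.

Let ratbox n (c : 'rV[rat]_n * nat) : set 'rV[R]_n :=
  [set x | forall i, `|ratr (c.1 ord0 i) - x ord0 i| < c.2.+1%:R^-1].

Let open_bigcup_ratbox n (U : set 'rV[R]_n) : open U ->
  U = \bigcup_c (if `[< ratbox c `<=` U >] then ratbox c else set0).
Proof.
move=> oU; apply/seteqP; split=> [x Ux|x [c _]]; last first.
  by case: asboolP => // cU; exact: cU.
have /nbhs_ballP[_/posnumP[e] eU] : nbhs x U by exact: open_nbhs_nbhs.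
have [k ke] : exists k, k.+1%:R^-1 < e%:num / 2 :> R.
  have [k _ /(_ _ (leqnn _))] := near_infty_natSinv_lt (e%:num / 2)%:pos.
  by exists k.
have /(_ _)/cid qP (i : 'I_n) :
    exists q : rat, `|ratr q - x ord0 i| < k.+1%:R^-1.
  have /rat_in_itvoo[q] : x ord0 i - k.+1%:R^-1 < x ord0 i + k.+1%:R^-1.
    by rewrite ltrBlDr -addrA ltrDl addr_gt0.
  by rewrite in_itv/= => qx; exists q; rewrite ltr_distl.
pose c : 'rV[rat]_n * nat := (\row_i sval (qP i), k).
have cx : ratbox c x by move=> i; rewrite /= mxE; exact: svalP (qP i).
exists c => //; case: asboolP => // -[] y cy; apply: eU; split => // i j.
rewrite (ord1 i); apply: (@ball_splitr _ R^o (ratr (c.1 ord0 j))).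
  by rewrite /ball/=; exact: lt_trans (cx j) ke.
by rewrite /ball/=; exact: lt_trans (cy j) ke.
Qed.

Lemma measurable_fun_rV d (T : measurableType d) n (f : T -> 'rV[R]_n) :
  (forall i, measurable_fun [set: T] (fun t => f t ord0 i : measurableTypeR R)) ->
  measurable_fun [set: T] f.
Proof.
move=> mf.
apply: (@measurability _ _ T 'rV[R]_n setT f (@open 'rV[R]_n) erefl) => //.
move=> _ [U oU <-]; rewrite setTI.
rewrite (open_bigcup_ratbox oU) preimage_bigcup.
apply: countable_bigcupT_measurable => // c; case: asboolP => _; last first.
  by rewrite preimage_set0.
rewrite (_ : _ @^-1` _ =
    \bigcap_(i in [set: 'I_n])
      ((fun t => f t ord0 i : measurableTypeR R) @^-1`
        (ball (ratr (c.1 ord0 i) : R) c.2.+1%:R^-1))).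
  apply: fin_bigcap_measurable => // i _; rewrite -[X in measurable X]setTI.
  by apply: mf => //; exact: open_measurable (ball_open _ _).
by apply/seteqP; split => [t ct i _|t ct i]; [exact: ct|exact: (ct i)].
Qed.
End borel_rV.

Section lebesgue_rV.
Context {R : realType}.
Local Notation RT := (measurableTypeR R).

Section cons.
Variable n : nat.

Definition rV_cons (z : RT * 'rV[R]_n) : 'rV[R]_n.+1 :=
  row_mx (z.1%:M : 'rV_1) z.2.

Definition rV_uncons (x : 'rV[R]_n.+1) : RT * 'rV[R]_n :=
  (x ord0 ord0, \row_i x ord0 (lift ord0 i)).

Lemma rV_cons0 z : rV_cons z ord0 ord0 = z.1.
Proof.
rewrite /rV_cons (_ : ord0 = lshift n (ord0 : 'I_1)); last exact: val_inj.
by rewrite (row_mxEl (z.1%:M : 'rV_1)) mxE eqxx mulr1n.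
Qed.

Lemma rV_consS z i : rV_cons z ord0 (lift ord0 i) = z.2 ord0 i.
Proof.
rewrite /rV_cons (_ : lift ord0 i = rshift 1 i); last exact: val_inj.
by rewrite (row_mxEr (z.1%:M : 'rV_1)).
Qed.

Lemma rV_consK : cancel rV_cons rV_uncons.
Proof.
move=> [a v]; rewrite /rV_uncons rV_cons0; congr pair.
by apply/rowP => i; rewrite mxE rV_consS.
Qed.

Lemma rV_unconsK : cancel rV_uncons rV_cons.
Proof.
move=> x; apply/rowP => i; have [j ->|->] := unliftP ord0 i.
  by rewrite rV_consS mxE.
by rewrite rV_cons0.
Qed.

Lemma measurable_rV_cons : measurable_fun [set: _] rV_cons.
Proof.
apply: measurable_fun_rV => i; have [j ->|->] := unliftP ord0 i.
  under eq_fun do rewrite rV_consS.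
  exact: (measurableT_comp (measurable_coord j) measurable_snd).
under eq_fun do rewrite rV_cons0.
exact: measurable_fst.
Qed.

Lemma measurable_rV_uncons : measurable_fun [set: _] rV_uncons.
Proof.
apply: measurable_fun_pair; first exact: measurable_coord.
apply: measurable_fun_rV => i.
by under eq_fun do rewrite mxE; exact: measurable_coord.
Qed.

Definition lebesgue_step (m : set 'rV[R]_n -> \bar R) : set 'rV[R]_n.+1 -> \bar R :=
  pushforward (@lebesgue_measure R \x m)%E rV_cons.

Section step.
Variable m : {sigma_finite_measure set 'rV[R]_n -> \bar R}.

HB.instance Definition _ := Measure.copy (lebesgue_step m)
  (measure_function_pushforward__canonical__measure_function_Measure
    (@lebesgue_measure R \x m)%E measurable_rV_cons).

Let lebesgue_step_sigma_finite : sigma_finite setT (lebesgue_step m).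
Proof.
have /sigma_finiteP[F [TF ndF Foo]] := sigma_finiteT (@lebesgue_measure R).
have /sigma_finiteP[G [TG ndG Goo]] := sigma_finiteT m.
exists (fun k => rV_uncons @^-1` (F k `*` G k)).
  rewrite -preimage_bigcup (_ : \bigcup_k _ = setT) ?preimage_setT//.
  apply/seteqP; split=> [//|[x y] _].
  have [[i _ Fx] [j _ Gy]] : (\bigcup_k F k) x /\ (\bigcup_k G k) y.
    by rewrite -TF -TG.
  exists (maxn i j) => //; split; move: Fx Gy => /= Fx Gy.
    by move: x Fx; exact/subsetPset/ndF/leq_maxl.
  by move: y Gy; exact/subsetPset/ndG/leq_maxr.
move=> k; have [mF Fk] := Foo k; have [mG Gk] := Goo k; split.
  rewrite -[X in measurable X]setTI.
  by apply: measurable_rV_uncons => //; exact: measurableX.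
rewrite /lebesgue_step /pushforward -comp_preimage.
rewrite (_ : rV_uncons \o rV_cons = id); last exact/funext/rV_consK.
by rewrite preimage_id product_measure1E// lte_mul_pinfty// ge0_fin_numE.
Qed.

HB.instance Definition _ := Measure_isSigmaFinite.Build _ _ _
  (lebesgue_step m) lebesgue_step_sigma_finite.
End step.
End cons.

(* n-dimensional Lebesgue measure on Borel sets, as the n-fold product of the
   one-dimensional one; lebesgue_rV_box characterises it. *)
Fixpoint lebesgue_rV n : {sigma_finite_measure set 'rV[R]_n -> \bar R} :=
  if n is k.+1 then lebesgue_step (lebesgue_rV k) else \d_(0 : 'rV[R]_0).

Lemma lebesgue_rV_box n (A : 'I_n -> set RT) : (forall i, measurable (A i)) ->
  lebesgue_rV n [set x | forall i, A i (x ord0 i)] =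
  (\prod_(i < n) lebesgue_measure (A i))%E.
Proof.
elim: n A => [|n IH] A mA.
  rewrite big_ord0 /= diracE mem_set//= => -[]//.
have mAS : measurable [set x : 'rV[R]_n | forall i, A (lift ord0 i) (x ord0 i)].
  rewrite (_ : [set _ | _] = \bigcap_(i in [set: 'I_n])
      ((fun x : 'rV[R]_n => x ord0 i : RT) @^-1` A (lift ord0 i))).
    apply: fin_bigcap_measurable => // i _; rewrite -[X in measurable X]setTI.
    exact: measurable_coord.
  by apply/seteqP; split => [x Ax i _|x Ax i]; exact: Ax.
rewrite big_ord_recl -IH//= /lebesgue_step /pushforward.
rewrite -product_measure1E//.
congr (_ _); apply/seteqP; split => [z Az|z [A0 AS] i /=].
  split => [|i]; first by rewrite -rV_cons0; exact: Az.
  by rewrite -rV_consS; exact: Az.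
by have [j ->|->] := unliftP ord0 i; rewrite ?rV_consS ?rV_cons0.
Qed.
End lebesgue_rV.

Section transport.
Context {R : realType} {n : nat}.
Local Notation V := 'rV[R]_n.
Implicit Types (Omega : set V) (x y z : V) (T : V -> V).

(* The norm of the normed module 'rV[R]_n is the sup norm, not this one. *)
Definition enorm x : R := Num.sqrt (\sum_(i < n) x ord0 i ^+ 2).

Definition cost (p : R) x y : R := p^-1 * enorm (x - y) `^ p.

(* The Dirac mass is the dummy value that mnormalize takes when Omega has
   measure 0. *)
Definition normalized_lebesgue Omega (cOmega : compact Omega) :
    probability V R :=
  mnormalize (mrestr (lebesgue_rV n) (compact_measurable_mx cOmega)) \d_(0 : V).

Definition two_diracs (lambda : R) x1 x2 : set V -> \bar R :=
  fun A => (lambda%:E * \d_x1 A + (1 - lambda)%:E * \d_x2 A)%E.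

(* Maps Omega -> R^n are represented by total functions, of which only the
   values on Omega matter. *)
Definition transport_map Omega (mu nu : set V -> \bar R) T :=
  measurable_fun Omega T /\
  forall A, measurable A -> mu (Omega `&` T @^-1` A) = nu A.

Definition transport_cost (p : R) Omega (mu : set V -> \bar R) T : \bar R :=
  (\int[mu]_(x in Omega) (cost p x (T x))%:E)%E.

Definition optimal_map p Omega mu nu T :=
  transport_map Omega mu nu T /\
  forall T', transport_map Omega mu nu T' ->
    (transport_cost p Omega mu T <= transport_cost p Omega mu T')%E.

Definition potential (p : R) x (b : R) z : R := - cost p x z + b.

Definition cell (p : R) Omega x1 x2 (b1 b2 : R) : set V :=
  [set q | Omega q /\ potential p x1 b1 q > potential p x2 b2 q].

Definition represents (p : R) Omega (mu : set V -> \bar R) (lambda : R) x1 x2 T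
    (b1 b2 : R) :=
  [/\ {in cell p Omega x1 x2 b1 b2, forall z, T z = x1},
      {in cell p Omega x2 x1 b2 b1, forall z, T z = x2},
      mu.-negligible
        [set z | Omega z /\ potential p x1 b1 z = potential p x2 b2 z],
      mu (cell p Omega x1 x2 b1 b2) = lambda%:E &
      mu (cell p Omega x2 x1 b2 b1) = (1 - lambda)%:E].
End transport.

(* Main.v *)
(** Write G(z) = (|x2 - z|^p - |x1 - z|^p) / p, so that the cells of x1 are the
superlevel sets of G in Omega. If p > 2, take x1 and x2 at distance 1 and Omega
a box around the line L through x1 orthogonal to x2 - x1: on the hyperplane
through x1 and x2 orthogonal to L, G is at most about 1 / p, and it is larger
at the points of L at distance 1 from x1, on either side. If p < 2, tilt
x2 - x1 slightly away from L by moving x2 back a distance a along L. Along L, in the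
direction opposite to x2, G first decreases as one walks away from x1 and later
grows without bound, because p > 1. In both cases a hyperplane orthogonal to L splits a superlevel
set of G. A thin box in the remaining coordinates changes nothing, and the
level can be taken null because almost every level is.
The map sending the superlevel set to x1 and the rest to x2 minimises
|z - T z|^p / p plus a function of T z at every z, hence is optimal. The level
is determined by the mass of its superlevel set, because relatively open subsets
of a convex body have positive measure. *)

Require Import Defs.
From mathcomp Require Import all_boot all_order all_algebra.
From mathcomp Require Import all_classical all_reals all_analysis.
From mathcomp Require Import measurable_realfun ring lra.
Import Order.TTheory GRing.Theory Num.Theory.
Import numFieldNormedType.Exports.
Local Open Scope classical_set_scope.
Local Open Scope ring_scope.

Set Implicit Arguments.
Unset Strict Implicit.
Unset Printing Implicit Defensive.

(** * Continuity and measurability of the transport cost *)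

(* [x `^ p] is 1 for [x < 0], so [powR] itself is not continuous at 0. *)
Lemma continuous_powR_comp (R : realType) (T : topologicalType) (f : T -> R)
    (p : R) :
  0 < p -> (forall x, 0 <= f x) -> continuous f ->
  continuous (fun x => f x `^ p).
Proof.
move=> p0 f0 cf x; have := f0 x; rewrite le_eqVlt => /predU1P[fx|fx].
  rewrite /continuous_at -fx powR0 ?gt_eqF//.
  apply/cvgr0Pnorm_lt => e e0.
  have eV : 0 < e `^ p^-1 by rewrite powR_gt0.
  have cfx : f y @[y --> x] --> 0 by rewrite fx; exact: cf.
  have /cvgr0Pnorm_lt/(_ _ eV) := cfx.
  apply: filterS => y; rewrite ger0_norm// => fy.
  rewrite ger0_norm ?powR_ge0//.
  have -> : e = (e `^ p^-1) `^ p by rewrite -powRrM mulVf ?powRr1 ?gt_eqF ?ltW.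
  by apply: gt0_ltr_powR; rewrite // nnegrE ?powR_ge0.
apply: (@continuous_comp _ _ _ f (fun x : R => x `^ p)); first exact: cf.
have d : derivable (fun x : R => x `^ p) (f x) 1.
  by apply: derivable_powR; rewrite in_itv/= fx.
exact/differentiable_continuous/derivable1_diffP.
Qed.

Lemma enorm_ge0 (R : realType) n (x : 'rV[R]_n) : 0 <= enorm x.
Proof. exact: sqrtr_ge0. Qed.

Lemma enorm_continuous (R : realType) n : continuous (@enorm R n).
Proof.
move=> x; apply: (@continuous_comp _ _ _
  (fun x : 'rV[R]_n => \sum_(i < n) x ord0 i ^+ 2) (@Num.sqrt R)); last first.
  exact: sqrt_continuous.
move: x; apply: continuous_big => [|i _ x]; first exact: add_continuous.
apply: (@continuous_comp _ _ _ (fun x : 'rV[R]_n => x ord0 i)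
  (fun x => x ^+ 2)).
  exact: coord_continuous.
exact: exprn_continuous.
Qed.

Lemma cost_ge0 (R : realType) n (p : R) (x y : 'rV[R]_n) :
  0 < p -> 0 <= cost p x y.
Proof. by move=> p0; rewrite mulr_ge0 ?powR_ge0 ?invr_ge0 ?ltW. Qed.

Lemma costC (R : realType) n (p : R) (x y : 'rV[R]_n) :
  cost p x y = cost p y x.
Proof.
rewrite /cost /enorm; congr (_ * Num.sqrt _ `^ _).
by apply: eq_bigr => i _; rewrite !mxE -sqrrN opprB.
Qed.

Lemma cost_continuous (R : realType) n (p : R) (x : 'rV[R]_n) :
  0 < p -> continuous (cost p x).
Proof.
move=> p0.
have cB : continuous (fun y : 'rV[R]_n => enorm (x - y)).
  move=> y; apply: (@continuous_comp _ _ _ (fun y : 'rV[R]_n => x - y)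
    (@enorm R n)).
    by apply: (@continuousB _ _ _ (cst x) id); [exact: cst_continuous|].
  exact: enorm_continuous.
have cP := continuous_powR_comp p0 
  (fun y : 'rV[R]_n => enorm_ge0 (x - y)) cB.
by move=> y; exact: (continuous_comp (cP y) (@mulrl_continuous _ p^-1 _)).
Qed.

Lemma continuous_measurable_rV (R : realType) n (f : 'rV[R]_n -> R) :
  continuous f -> measurable_fun setT f.
Proof.
move=> cf; apply: (measurability _ (RGenOpens.measurableE R)).
move=> _ [_ [a [b ->]] <-]; rewrite setTI; apply: open_measurable_mx.
by apply: open_comp => // x _; exact: cf.
Qed.

Lemma measurable_cost (R : realType) n (p : R) (D : set 'rV[R]_n)
    (T : 'rV[R]_n -> 'rV[R]_n) :
  measurable D -> measurable_fun D T ->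
  measurable_fun D (fun z => cost p z (T z)).
Proof.
move=> mD mT.
have mc i : measurable_fun D (fun z : 'rV[R]_n => (z - T z) ord0 i).
  rewrite (_ : (fun z => _) =
    (fun z : 'rV[R]_n => z ord0 i) \- (fun z => T z ord0 i)); last first.
    by apply/funext => z; rewrite !mxE.
  apply: measurable_funB.
    by apply: measurable_funTS; exact: measurable_coord.
  exact: (measurableT_comp (measurable_coord i) mT).
have ms : measurable_fun D
    (fun z : 'rV[R]_n => \sum_(i < n) (z - T z) ord0 i ^+ 2).
  by apply: measurable_sum => i; exact: measurable_funX.
have mq := measurableT_comp
  (continuous_measurable_fun (@sqrt_continuous R)) ms.
exact: measurable_funM (measurable_cst _)
  (measurableT_comp (measurable_powR p) mq).
Qed.

(** * Existence of null levels *)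

(* Fubini for [mu] and Lebesgue measure on the graph of [f]: its sections over
   T are singletons, so almost all its sections over R are null. *)
Lemma exists_null_level (R : realType) d (T : measurableType d)
    (mu : probability T R) (f : T -> measurableTypeR R) (a b : R) :
  measurable_fun setT f -> a < b ->
  exists c, a < c < b /\ mu (f @^-1` [set c]) = 0%E.
Proof.
move=> mf ab.
pose A : set (T * measurableTypeR R) := [set z | f z.1 - z.2 = 0 :> R].
have mA : measurable A.
  have mh : measurable_fun setT
      (fun z : T * measurableTypeR R => f z.1 - z.2 : measurableTypeR R).
    by apply: measurable_funB => //; exact: measurableT_comp.
  rewrite (_ : A = setT `&` (fun z : T * measurableTypeR R =>
      f z.1 - z.2 : measurableTypeR R) @^-1` [set 0]); last by rewrite setTI.
  by apply: mh => //; exact: measurable_set1.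
have := @indic_fubini_tonelli _ _ T (measurableTypeR R) R mu
  (@lebesgue_measure R) A mA.
rewrite indic_fubini_tonelli_FE// indic_fubini_tonelli_GE//.
rewrite (eq_integral (cst 0%E)); last first.
  move=> x _ /=.
  rewrite (_ : xsection A x = [set f x]) ?lebesgue_measure_set1//.
  apply/seteqP; split => y; rewrite /xsection/= in_setE /A/=.
    by move/eqP; rewrite subr_eq0 eq_sym => /eqP.
  by move=> ->; rewrite subrr.
rewrite integral0 => /esym h.
have /ae_eq_integral_abs : (\int[@lebesgue_measure R]_y
    `|(mu \o ysection A) y| = 0)%E.
  by rewrite -[RHS]h; apply: eq_integral => y _; rewrite gee0_abs.
move=> /(_ measurableT) /(_ (measurable_fun_ysection _ mA)).
move=> [N [mN N0 hN]].
(* If no level in []a, b[] were null, this interval of positive length would lie inside the null set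
   [N]. *)
apply: contrapT => hc.
have : (lebesgue_measure `]a, b[%classic <= lebesgue_measure N)%E.
  apply: le_measure; rewrite ?inE// => c cab; apply: hN => /=.
  move=> /(_ I) h0; apply: hc; exists c; split.
    by move: cab; rewrite /= in_itv.
  rewrite -[RHS]h0; congr (mu _).
  apply/seteqP; split => y; rewrite /ysection/= in_setE /A/=.
    by move=> ->; rewrite subrr.
  by move/eqP; rewrite subr_eq0 => /eqP.
rewrite N0 lebesgue_measure_itv/= lte_fin ab -EFinD lee_fin subr_le0.
by rewrite leNgt ab.
Qed.

(** * Lebesgue measure of compact sets and convex bodies *)

Lemma lebesgue_rV_ball (R : realType) n (x : 'rV[R]_n) (r : R) :
  0 < r -> lebesgue_rV n (ball x r) = ((r *+ 2) ^+ n)%:E.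
Proof.
move=> r0; rewrite (_ : ball x r =
    [set y | forall i, ball (x ord0 i) r (y ord0 i)]); last first.
  apply/seteqP; split => [y [_ h] i|y h]; first exact: h.
  by split => // i j; rewrite (ord1 i); exact: h.
rewrite (@lebesgue_rV_box R n (fun i => ball (x ord0 i) r)); last first.
  by move=> i; exact: measurable_ball.
under eq_bigr do rewrite lebesgue_measure_ball ?ltW//.
by rewrite prodEFin prodr_const card_ord.
Qed.

Lemma lebesgue_rV_compact_lty (R : realType) n (K : set 'rV[R]_n) :
  compact K -> (lebesgue_rV n K < +oo)%E.
Proof.
move=> cK; have [M [_ KM]] := compact_bounded cK.
(* Only numbers strictly above [M] bound the norm on [K], and [M] may be negative: [|M| + 1] is such
   a bound, and the further 1 makes the ball open. *)
pose r := `|M| + 2.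
have r0 : 0 < r by rewrite ltr_wpDl.
apply: (@le_lt_trans _ _ (lebesgue_rV n (ball 0 r))); last first.
  by rewrite lebesgue_rV_ball// ltry.
apply: le_measure; rewrite ?inE.
- exact: compact_measurable_mx.
- by apply: open_measurable_mx; exact: ball_open.
- move=> x Kx; rewrite -ball_normE/= sub0r normrN.
  have /le_lt_trans : `|x| <= `|M| + 1.
    by apply: KM Kx; rewrite (le_lt_trans (ler_norm M))// ltrDl.
  by apply; rewrite ltrD2l ltrDl.
Qed.

Lemma convex_set_segment (R : realType) n (Omega : set 'rV[R]_n) x y (t : R) :
  convex_set Omega -> 0 <= t -> t <= 1 -> Omega x -> Omega y ->
  Omega (t *: x + (1 - t) *: y).
Proof.
move=> cO t0 t1 Ox Oy; apply: set_mem.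
by apply: (cO x y (Itv01 t0 t1)); rewrite inE.
Qed.

(* Omega contains a copy of the ball at q shrunk towards z. *)
Lemma convex_open_lebesgue_rV_gt0 (R : realType) n (Omega U : set 'rV[R]_n)
    (q z : 'rV[R]_n) (r : R) :
  convex_set Omega -> measurable Omega -> 0 < r -> ball q r `<=` Omega ->
  open U -> Omega z -> U z -> (0 < lebesgue_rV n (Omega `&` U))%E.
Proof.
move=> cO mO r0 qO oU Oz Uz.
have /nbhs_ballP[e/= e0 eU] : nbhs z U by exact: open_nbhs_nbhs.
(* [M] exceeds the distance from [z] to every point of [ball q r], so a homothety at [z] of ratio
   [t], with [t * M <= e], moves that ball into [U]. *)
pose M := `|q - z| + r + 1.
have M0 : 0 < M by rewrite ltr_wpDl ?addr_ge0// ltW.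
pose t := Num.min 1 (e / M).
have t0 : 0 < t by rewrite /t lt_min ltr01 divr_gt0.
have t1 : t <= 1 by rewrite /t ge_min lexx.
have tM : t * M <= e by rewrite -ler_pdivlMr// /t ge_min lexx orbT.
pose w := t *: q + (1 - t) *: z.
have tr0 : 0 < t * r by rewrite mulr_gt0.
apply: (@lt_le_trans _ _ (lebesgue_rV n (ball w (t * r)))).
  by rewrite lebesgue_rV_ball// lte_fin exprn_gt0// mulrn_wgt0.
apply: le_measure; rewrite ?inE.
- by apply: open_measurable_mx; exact: ball_open.
- by apply: measurableI => //; exact: open_measurable_mx.
- move=> y; rewrite -ball_normE /ball_/= => wy.
  (* The preimage of [y] under the homothety. *)
  pose v := z + t^-1 *: (y - z).
  have Hy : y = t *: v + (1 - t) *: z.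
    by apply/rowP => j; rewrite !mxE; field; rewrite gt_eqF.
  have Hw : w - y = t *: (q - v).
    by apply/rowP => j; rewrite !mxE; field; rewrite gt_eqF.
  have qv : `|q - v| < r.
    by move: wy; rewrite Hw normrZ (gtr0_norm t0) ltr_pM2l.
  have vO : Omega v by apply: qO; rewrite -ball_normE.
  split; first by rewrite Hy; apply: convex_set_segment => //; exact: ltW.
  apply: eU; rewrite -ball_normE/=; apply: lt_le_trans tM.
  rewrite (_ : z - y = t *: ((q - v) - (q - z))); last first.
    by apply/rowP => j; rewrite !mxE; field; rewrite gt_eqF.
  rewrite normrZ (gtr0_norm t0) ltr_pM2l// /M (le_lt_trans (ler_normB _ _))//.
  by rewrite addrC -addrA ltrD2l ltr_wpDr.
Qed.

(** * Cells as superlevel sets, and optimality of the cell map *)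

Definition cost_gap (R : realType) n (p : R) (x1 x2 z : 'rV[R]_n) : R :=
  cost p x2 z - cost p x1 z.

Lemma cost_gap_continuous (R : realType) n (p : R) (x1 x2 : 'rV[R]_n) :
  0 < p -> continuous (cost_gap p x1 x2).
Proof.
by move=> p0 z; apply: continuousB; exact: cost_continuous.
Qed.

Lemma cellE (R : realType) n (p : R) (Omega : set 'rV[R]_n) x1 x2 b1 b2 :
  cell p Omega x1 x2 b1 b2 =
  Omega `&` [set z | b2 - b1 < cost_gap p x1 x2 z].
Proof.
apply/seteqP; split => z [Oz h]; split => //; move: h;
  rewrite /potential /cost_gap /=;
  move: (cost p x1 z) (cost p x2 z) => u v; lra.
Qed.

Lemma cell_swapE (R : realType) n (p : R) (Omega : set 'rV[R]_n) x1 x2 b1 b2 :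
  cell p Omega x2 x1 b2 b1 =
  Omega `&` [set z | cost_gap p x1 x2 z < b2 - b1].
Proof.
apply/seteqP; split => z [Oz h]; split => //; move: h;
  rewrite /potential /cost_gap /=;
  move: (cost p x1 z) (cost p x2 z) => u v; lra.
Qed.

(** The weights contribute a quantity depending on [nu] alone, since a transport map gives the
    preimage of a point the mass that [nu] gives to the point. Two maps with the same target can
    thus be compared through the weighted integrand, pointwise. *)
Lemma transport_costD (R : realType) n (p : R) (Omega : set 'rV[R]_n)
    (mu : {measure set 'rV[R]_n -> \bar R}) (nu : set 'rV[R]_n -> \bar R)
    (T : 'rV[R]_n -> 'rV[R]_n) x1 x2 (b1 b2 : R) :
  0 < p -> 0 <= b1 -> 0 <= b2 -> measurable Omega ->
  transport_map Omega mu nu T ->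
  (\int[mu]_(z in Omega) ((cost p z (T z))%:E +
     (b1%:E * (\1_(Omega `&` T @^-1` [set x1]) z)%:E +
      b2%:E * (\1_(Omega `&` T @^-1` [set x2]) z)%:E)) =
   transport_cost p Omega mu T + (b1%:E * nu [set x1] + b2%:E * nu [set x2]))%E.
Proof.
move=> p0 b10 b20 mO [mT nuT].
have m1 (x : 'rV[R]_n) : measurable [set x].
  by apply: compact_measurable_mx; exact: compact_set1.
have mS x : measurable (Omega `&` T @^-1` [set x]) by exact: mT.
have mI (b : R) x : measurable_fun Omega
    (fun z => b%:E * (\1_(Omega `&` T @^-1` [set x]) z)%:E)%E.
  apply: measurable_funeM; apply/measurable_EFinP.
  by apply: measurable_funTS; exact: measurable_indic.
have I0 (b : R) x z : 0 <= b ->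
    (0 <= b%:E * (\1_(Omega `&` T @^-1` [set x]) z)%:E)%E.
  by move=> b0; rewrite mule_ge0 ?lee_fin.
have IE (b : R) x : 0 <= b -> (\int[mu]_(z in Omega)
    (b%:E * (\1_(Omega `&` T @^-1` [set x]) z)%:E) = b%:E * nu [set x])%E.
  move=> b0; rewrite ge0_integralZl//; last first.
    apply/measurable_EFinP.
    by apply: measurable_funTS; exact: measurable_indic.
  by rewrite integral_indic// -nuT// setIAC setIid.
have mc := (measurable_EFinP _ _).2 (measurable_cost p mO mT).
have c0 z : Omega z -> (0 <= (cost p z (T z))%:E)%E.
  by move=> _; rewrite lee_fin cost_ge0.
rewrite (ge0_integralD mu mO c0 mc); last 2 first.
- by move=> z _; rewrite adde_ge0// I0.
- by apply: emeasurable_funD; exact: mI.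
congr (_ + _)%E.
rewrite (ge0_integralD mu mO (fun z _ => I0 b1 x1 z b10) (mI b1 x1)
  (fun z _ => I0 b2 x2 z b20) (mI b2 x2)).
by rewrite !IE.
Qed.

(** Ties go to [x2]; the level [c] will be chosen so that they form a null set. *)
Definition cell_map (R : realType) n (p : R) (x1 x2 : 'rV[R]_n) (c : R) :=
  fun z => if c < cost_gap p x1 x2 z then x1 else x2.

Section cell_map_optimal.
Context (R : realType) (n : nat) (p : R) (Omega : set 'rV[R]_n).
Context (mu : probability 'rV[R]_n R) (x1 x2 : 'rV[R]_n) (c : R).
Context (p0 : 0 < p) (mO : measurable Omega) (muO : mu Omega = 1%E).
Context (x12 : x1 <> x2).
Let U := [set z | c < cost_gap p x1 x2 z].
Let lambda := fine (mu (Omega `&` U)).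

Let mU : measurable U.
Proof.
apply: open_measurable_mx.
rewrite (_ : U = cost_gap p x1 x2 @^-1` [set y | c < y]) //.
by apply: open_comp; [move=> z _; exact: cost_gap_continuous|exact: open_gt].
Qed.

Let lambdaE : mu (Omega `&` U) = lambda%:E.
Proof. by rewrite fineK// fin_num_measure//; exact: measurableI. Qed.

Let lambdaC : mu (Omega `&` ~` U) = (1 - lambda)%:E.
Proof.
rewrite -setDE measureD//; last by rewrite [ltLHS]muO ltry.
by rewrite [X in (X - _)%E]muO [X in (_ - X)%E]lambdaE.
Qed.

Lemma cell_map_transport :
  transport_map Omega mu (two_diracs lambda x1 x2) (cell_map p x1 x2 c).
Proof.
(* The conditions [A x1] and [A x2] enter as constant sets, each of which is everything or empty;
   this leaves four cases. *)
have E A : Omega `&` cell_map p x1 x2 c @^-1` A =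
    (Omega `&` U `&` [set _ | A x1]) `|` (Omega `&` ~` U `&` [set _ | A x2]).
  apply/seteqP; split=> [z [Oz]|z [|] [[Oz Uz]] Ax]; rewrite /cell_map/=.
  - by case: ifPn => h Ax; [left|right]; do 2 split => //; exact/negP.
  - by split => //; move: Uz; rewrite /U/= => ->.
  - by split => //; move: Uz; rewrite /U/= => /negP/negbTE ->.
have cT (P : Prop) : P -> [set _ : 'rV[R]_n | P] = setT.
  by move=> ?; apply/seteqP; split.
have cF (P : Prop) : ~ P -> [set _ : 'rV[R]_n | P] = set0.
  by move=> ?; apply/seteqP; split.
split.
  move=> _ A mA; rewrite E.
  have mC (P : Prop) : measurable [set _ : 'rV[R]_n | P].
    by have [p1|p1] := pselect P; [rewrite cT|rewrite cF].
  apply: measurableU; apply: measurableI => //; apply: measurableI => //.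
  exact: measurableC.
move=> A mA; rewrite E /two_diracs !diracE.
have [A1|A1] := pselect (A x1); have [A2|A2] := pselect (A x2).
- rewrite !cT// !setIT -setIUr setUv setIT [LHS]muO !mem_set//.
  by rewrite !mule1 -EFinD addrC subrK.
- rewrite cT// cF// setIT setI0 setU0 [LHS]lambdaE mem_set// memNset//.
  by rewrite mule1 mule0 adde0.
- rewrite cF// cT// setIT setI0 set0U [LHS]lambdaC memNset// mem_set//.
  by rewrite mule1 mule0 add0e.
- by rewrite !cF// !setI0 setU0 measure0 !memNset// !mule0 adde0.
Qed.

Lemma cell_map_optimal :
  optimal_map p Omega mu (two_diracs lambda x1 x2) (cell_map p x1 x2 c).
Proof.
split; first exact: cell_map_transport.
move=> T hT.
(* [cell_map] minimises [cost p z x] plus [b1] or [b2], according to [x], at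
   every z; nonnegative weights keep all the integrals in [0, +oo]. *)
have [b1 [b2 [b10 b20 b12]]] :
    exists b1 b2, [/\ 0 <= b1, 0 <= b2 & c = b1 - b2].
  exists (Num.max c 0), (Num.max c 0 - c); rewrite subKr subr_ge0.
  by rewrite !le_max !lexx orbT.
(* Finiteness allows this common constant to be added on both sides of the inequality. *)
have finN : (b1%:E * two_diracs lambda x1 x2 [set x1] +
    b2%:E * two_diracs lambda x1 x2 [set x2])%E \is a fin_num.
  by rewrite /two_diracs !diracE -!EFinM -!EFinD.
rewrite -(leeD2rE _ _ finN).
rewrite -[leRHS](transport_costD x1 x2 p0 b10 b20 mO hT).
rewrite -[leLHS](transport_costD x1 x2 p0 b10 b20 mO cell_map_transport).
have m1 (x : 'rV[R]_n) : measurable [set x].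
  by apply: compact_measurable_mx; exact: compact_set1.
have f0 T' z : Omega z -> (0 <= (cost p z (T' z))%:E +
     (b1%:E * (\1_(Omega `&` T' @^-1` [set x1]) z)%:E +
      b2%:E * (\1_(Omega `&` T' @^-1` [set x2]) z)%:E))%E.
  by move=> _; rewrite !adde_ge0 ?mule_ge0 ?lee_fin ?cost_ge0.
have mf T' : transport_map Omega mu (two_diracs lambda x1 x2) T' ->
    measurable_fun Omega (fun z => (cost p z (T' z))%:E +
     (b1%:E * (\1_(Omega `&` T' @^-1` [set x1]) z)%:E +
      b2%:E * (\1_(Omega `&` T' @^-1` [set x2]) z)%:E))%E.
  move=> [mT' _].
  have mI (b : R) x : measurable_fun Omega
      (fun z => b%:E * (\1_(Omega `&` T' @^-1` [set x]) z)%:E)%E.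
    apply: measurable_funeM; apply/measurable_EFinP.
    by apply: measurable_funTS; apply: measurable_indic; exact: mT'.
  apply: emeasurable_funD; last by apply: emeasurable_funD; exact: mI.
  by apply/measurable_EFinP; exact: measurable_cost.
apply: ae_ge0_le_integral => //; [exact: f0|exact: mf cell_map_transport|
  exact: f0|exact: mf hT|].
case: hT => mT nuT.
(* The pointwise comparison can fail only where [T] takes a third value, and [nu] gives such values
   no mass. *)
have m2 : measurable (~` [set x1; x2]).
  exact: measurableC (measurableU _ _ (m1 x1) (m1 x2)).
exists (Omega `&` T @^-1` ~` [set x1; x2]); split.
- exact: mT.
- rewrite [LHS]nuT// /two_diracs !diracE !memNset ?mule0 ?adde0//; apply;
    first [by left|by right].
- move=> z /= hz; apply: contrapT => hz'; apply: hz => Oz.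
  have Tz : T z = x1 \/ T z = x2.
    by apply: contrapT => h; apply: hz'; split => //= Tz; apply: h; exact: Tz.
  have ind (T' : 'rV[R]_n -> 'rV[R]_n) (x : 'rV[R]_n) :
      \1_(Omega `&` T' @^-1` [set x]) z = (T' z == x)%:R :> R.
    rewrite indicE; congr (_%:R); congr nat_of_bool.
    apply/idP/idP => [/set_mem[_ /= ->]//|/eqP h].
    by apply/mem_set; split.
  rewrite !(ind T) !(ind (cell_map p x1 x2 c)).
  have toE (k k' u v u' v' : R) :
      k + (b1 * u + b2 * v) <= k' + (b1 * u' + b2 * v') ->
      (k%:E + (b1%:E * u%:E + b2%:E * v%:E) <=
       k'%:E + (b1%:E * u'%:E + b2%:E * v'%:E))%E.
    by rewrite -!EFinM -!EFinD lee_fin.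
  apply: toE.
  have x21 : (x2 == x1) = false by apply/eqP => /esym.
  have x12' : (x1 == x2) = false by apply/eqP.
  rewrite /cell_map; case: ifPn; rewrite /cost_gap -?leNgt => h;
    case: Tz => ->; rewrite !eqxx ?x21 ?x12' !mulr1 !mulr0 !(costC _ z);
    move: h; rewrite b12; move: (cost p x1 z) (cost p x2 z) => u v; lra.
Qed.

(** The cells depend on [b2 - b1] alone, so [0] and [c] serve as constants. The set sent to [x2] is
    the open cell of [x2] together with the level set, which has mass 0. *)
Lemma cell_map_represents :
  mu (Omega `&` cost_gap p x1 x2 @^-1` [set c]) = 0%E ->
  represents p Omega mu lambda x1 x2 (cell_map p x1 x2 c) 0 c.
Proof.
move=> mu0.
have mE : measurable (Omega `&` cost_gap p x1 x2 @^-1` [set c]).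
  apply: measurableI => //; apply: closed_measurable_mx.
  apply: closed_comp; last exact: closed_eq.
  by move=> z _; exact: cost_gap_continuous.
split.
- move=> z; rewrite inE cellE subr0 => -[_ /= h].
  by rewrite /cell_map h.
- move=> z; rewrite inE cell_swapE subr0 => -[_ /= h].
  by rewrite /cell_map ltNge ltW.
- exists (Omega `&` cost_gap p x1 x2 @^-1` [set c]); split => //.
  move=> z [Oz]; rewrite /potential /cost_gap => h; split => //=.
  by move: h; move: (cost p x1 z) (cost p x2 z) => u v; lra.
- by rewrite cellE subr0 lambdaE.
- rewrite cell_swapE subr0 -lambdaC.
  have -> : Omega `&` ~` U = (Omega `&` [set z | cost_gap p x1 x2 z < c]) `|`
      (Omega `&` cost_gap p x1 x2 @^-1` [set c]).
    apply/seteqP; split=> [z [Oz]|z [|] [Oz]]; rewrite /U/=.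
    + move=> /negP; rewrite -leNgt le_eqVlt => /predU1P[|]; first by right.
      by left.
    + by move=> h; split => //; apply/negP; rewrite -leNgt ltW.
    + by move=> ->; split => //; rewrite ltxx.
  rewrite measureU//; first by rewrite [X in (_ + X)%E]mu0 adde0.
    apply: measurableI => //; apply: open_measurable_mx.
    rewrite (_ : [set _ | _] = cost_gap p x1 x2 @^-1` [set y | y < c]) //.
    apply: open_comp; last exact: open_lt.
    by move=> z _; exact: cost_gap_continuous.
  by apply/seteqP; split => // z [[_ /= h] [_ /= h']]; move: h; rewrite h' ltxx.
Qed.

End cell_map_optimal.

(** * The normalised Lebesgue measure *)

Section normalized_lebesgue.
Context (R : realType) (n : nat) (Omega : set 'rV[R]_n) (cO : compact Omega).
Context (O0 : (0 < lebesgue_rV n Omega)%E).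

Let mO : measurable Omega := compact_measurable_mx cO.

Let O_fin : lebesgue_rV n Omega \is a fin_num.
Proof. by rewrite ge0_fin_numE// lebesgue_rV_compact_lty. Qed.

(** The mass of [Omega] is neither 0 nor infinite, so [mnormalize] does not return its Dirac
    default. *)
Lemma normalized_lebesgueE A : normalized_lebesgue cO A =
  (lebesgue_rV n (A `&` Omega) * (fine (lebesgue_rV n Omega))^-1%:E)%E.
Proof.
have -> : lebesgue_rV n Omega = lebesgue_rV n (setT `&` Omega) by rewrite setTI.
rewrite /normalized_lebesgue /= /mnormalize /mrestr ifF//=.
by rewrite /mrestr setTI gt_eqF//= lt_eqF// ltey_eq O_fin.
Qed.

Lemma normalized_lebesgue_self : normalized_lebesgue cO Omega = 1%E.
Proof.
rewrite normalized_lebesgueE setIid -{1}(fineK O_fin) -EFinM divff//.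
by rewrite gt_eqF// fine_gt0// O0 lebesgue_rV_compact_lty.
Qed.

Lemma normalized_lebesgue_gt0 (A : set 'rV[R]_n) :
  (0 < lebesgue_rV n (Omega `&` A))%E ->
  (0 < normalized_lebesgue cO (Omega `&` A))%E.
Proof.
move=> A0; rewrite normalized_lebesgueE setIAC setIid mule_gt0//.
by rewrite lte_fin invr_gt0 fine_gt0// O0 lebesgue_rV_compact_lty.
Qed.

End normalized_lebesgue.

(** * Disconnection, intermediate values and uniqueness of the level *)

(** The part of [A] where [f < m] is relatively open, and relatively closed because [f] avoids [m]
    on [A]. It contains [P], so connectedness would put [Q] in it. *)
Lemma disconnected_by_level (R : realType) (T : topologicalType) (A : set T)
    (f : T -> R) (m : R) (P Q : T) :
  continuous f -> A P -> A Q -> f P < m -> m < f Q ->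
  (forall z, A z -> f z != m) -> ~ connected A.
Proof.
move=> cf AP AQ fP fQ fm cA.
suff : (A `&` f @^-1` [set y | y < m]) Q.
  by case=> _ /= /lt_trans/(_ fQ); rewrite ltxx.
rewrite (cA (A `&` f @^-1` [set y | y < m])) //.
- by exists P.
- by exists (f @^-1` [set y | y < m]) => //;
    apply: open_comp; [move=> z _; exact: cf|exact: open_lt].
- exists (f @^-1` [set y | y <= m]).
    by apply: closed_comp; [move=> z _; exact: cf|exact: closed_le].
  apply/seteqP; split => z [Az /= fz]; split => //=; first exact: ltW.
  by rewrite lt_neqAle fm.
Qed.

Lemma convex_set_IVT (R : realType) n (Omega : set 'rV[R]_n)
    (f : 'rV[R]_n -> R) u v (y : R) :
  convex_set Omega -> continuous f -> Omega u -> Omega v ->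
  f u <= y -> y <= f v -> exists2 z, Omega z & f z = y.
Proof.
move=> cO cf Ou Ov uy yv.
pose h (t : R) := t *: (v - u) + u.
have ch : continuous h.
  move=> t.
  apply: (@continuousD _ _ _ (fun t : R => t *: (v - u)) (cst u)).
    exact: scalel_continuous.
  exact: cst_continuous.
have h0 : h 0 = u by rewrite /h scale0r add0r.
have h1 : h 1 = v by rewrite /h scale1r subrK.
have [|||t] := @IVT R (f \o h) 0 1 y.
- exact: ler01.
- apply: continuous_subspaceT => t.
  by apply: continuous_comp; [exact: ch|exact: cf].
- by rewrite /= h0 h1 ge_min uy le_max yv orbT.
rewrite in_itv/= => /andP[t0 t1] ft; exists (h t) => //.
have -> : h t = t *: v + (1 - t) *: u.
  by apply/rowP => j; rewrite !mxE; ring.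
exact: convex_set_segment.
Qed.

Section level.
Context (R : realType) (n : nat) (Omega : set 'rV[R]_n) (cO : compact Omega).
Context (f : 'rV[R]_n -> R) (q : 'rV[R]_n) (r : R).
Context (vO : convex_set Omega) (r0 : 0 < r) (qO : ball q r `<=` Omega).
Context (cf : continuous f).

Let mO : measurable Omega := compact_measurable_mx cO.

Lemma convex_lebesgue_rV_gt0 : (0 < lebesgue_rV n Omega)%E.
Proof.
rewrite -(setIT Omega).
apply: (convex_open_lebesgue_rV_gt0 vO mO r0 qO openT (z := q)) => //.
by apply: qO; exact: ballxx.
Qed.

Lemma normalized_lebesgue_open_gt0 (U : set 'rV[R]_n) z :
  open U -> Omega z -> U z -> (0 < normalized_lebesgue cO (Omega `&` U))%E.
Proof.
move=> oU Oz Uz; apply: normalized_lebesgue_gt0.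
  exact: convex_lebesgue_rV_gt0.
exact: (convex_open_lebesgue_rV_gt0 vO mO r0 qO oU Oz Uz).
Qed.

(** Some point of [Omega] has its value strictly between the two levels; the relatively open band
    around it has positive mass. *)
Lemma normalized_lebesgue_superlevel_lt (c1 c2 : R) u v : c1 < c2 ->
  Omega u -> Omega v -> f u < c2 -> c1 < f v ->
  (normalized_lebesgue cO (Omega `&` [set z | (c2 < f z)%R]) <
   normalized_lebesgue cO (Omega `&` [set z | (c1 < f z)%R]))%E.
Proof.
move=> c12 Ou Ov fu fv.
have [z Oz [fz1 fz2]] : exists2 z, Omega z & c1 < f z /\ f z < c2.
  have [?|fu1] := ltP c1 (f u); first by exists u.
  have [?|fv2] := ltP (f v) c2; first by exists v.
  (* Here [f u <= c1] and [c2 <= f v], so the midpoint of the two levels is attained. *)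
  have [||z Oz fz] := convex_set_IVT (y := (c1 + c2) / 2) vO cf Ou Ov.
  - by move: fu1 c12; move: (f u) => a; lra.
  - by move: fv2 c12; move: (f v) => a; lra.
  by exists z => //; rewrite fz; split; lra.
pose W := [set z | c1 < f z] `&` [set z | f z < c2].
have oG (c : R) : open [set z | c < f z].
  rewrite (_ : [set _ | _] = f @^-1` [set y | c < y])//.
  by apply: open_comp; [move=> w _; exact: cf|exact: open_gt].
have oL (c : R) : open [set z | f z < c].
  rewrite (_ : [set _ | _] = f @^-1` [set y | y < c])//.
  by apply: open_comp; [move=> w _; exact: cf|exact: open_lt].
have oW : open W by apply: openI.
have mg U : open U -> measurable (Omega `&` U).
  by move=> oU; apply: measurableI => //; exact: open_measurable_mx.
have W0 := normalized_lebesgue_open_gt0 oW Oz (conj fz1 fz2).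
apply: (@lt_le_trans _ _ (normalized_lebesgue cO
    ((Omega `&` [set z | (c2 < f z)%R]) `|` (Omega `&` W)))).
  rewrite measureU//; [|exact: mg|exact: mg|].
    by rewrite lteDl// fin_num_measure//; exact: mg.
  by apply/seteqP; split => // w [[_ /= ?] [_ [_ /= ?]]]; lra.
apply: le_measure; rewrite ?inE; [apply: measurableU|exact: mg|]; try exact: mg.
move=> w [[Ow /= h]|[Ow [/= h _]]]; split => //=; exact: lt_trans h.
Qed.

Lemma normalized_lebesgue_superlevel_inj (c1 c2 : R) u v :
  Omega u -> Omega v -> f u < c1 -> c1 < f v ->
  normalized_lebesgue cO (Omega `&` [set z | c1 < f z]) =
  normalized_lebesgue cO (Omega `&` [set z | c2 < f z]) -> c1 = c2.
Proof.
move=> Ou Ov fu fv E; apply/eqP; rewrite eq_le !leNgt; apply/andP; split;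
  apply/negP => c12.
- have := normalized_lebesgue_superlevel_lt c12 Ou Ov fu (lt_trans c12 fv).
  by rewrite E ltxx.
- have := normalized_lebesgue_superlevel_lt c12 Ou Ov (lt_trans fu c12) fv.
  by rewrite E ltxx.
Qed.

End level.

(** * From a separating slice to a disconnected cell *)

(** At a level above [c0] but below the values at [P] and [Q], the superlevel set contains both
    points and misses the slice [z_i = m] between them. *)
Lemma disconnected_cell (R : realType) n (p : R) (Omega : set 'rV[R]_n)
    (cO : compact Omega) (q x1 x2 P Q : 'rV[R]_n) (r : R) (i : 'I_n)
    (m c0 : R) :
  0 < p -> convex_set Omega -> 0 < r -> ball q r `<=` Omega -> x1 <> x2 ->
  Omega P -> Omega Q -> P ord0 i < m -> m < Q ord0 i ->
  c0 < cost_gap p x1 x2 P -> c0 < cost_gap p x1 x2 Q ->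
  (forall z, Omega z -> z ord0 i = m -> cost_gap p x1 x2 z <= c0) ->
  exists lambda : R, 0 < lambda < 1 /\
    let mu := normalized_lebesgue cO in
    let nu := two_diracs lambda x1 x2 in
    (exists T b1 b2, optimal_map p Omega mu nu T /\
       represents p Omega mu lambda x1 x2 T b1 b2) /\
    (forall T b1 b2, optimal_map p Omega mu nu T ->
       represents p Omega mu lambda x1 x2 T b1 b2 ->
       ~ connected (cell p Omega x1 x2 b1 b2)).
Proof.
move=> p0 vO r0 qO x12 OP OQ Pm mQ c0P c0Q slice.
have mO := compact_measurable_mx cO.
have cG := cost_gap_continuous (x1 := x1) (x2 := x2) p0.
have O0 := convex_lebesgue_rV_gt0 cO vO r0 qO.
set mu := normalized_lebesgue cO.
have muO : mu Omega = 1%E by exact: normalized_lebesgue_self.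
have cc : continuous (fun z : 'rV[R]_n => z ord0 i) by exact: coord_continuous.
(* [S] lies on the slice, hence below the level chosen next: it gives the cell of [x2] positive
   mass, and is the low point required for uniqueness of the level. *)
have [S OS Sm] := convex_set_IVT vO cc OP OQ (ltW Pm) (ltW mQ).
have c01 : c0 < Num.min (cost_gap p x1 x2 P) (cost_gap p x1 x2 Q).
  by rewrite lt_min c0P c0Q.
have [c [/andP[c0c +] muc]] :=
  exists_null_level mu (continuous_measurable_rV cG) c01.
rewrite lt_min => /andP[GP GQ].
have muc' : mu (Omega `&` cost_gap p x1 x2 @^-1` [set c]) = 0%E.
  apply/eqP; rewrite eq_le measure_ge0 andbT -[leRHS]muc.
  have mL : measurable (cost_gap p x1 x2 @^-1` [set c]).
    apply: closed_measurable_mx; apply: closed_comp; last exact: closed_eq.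
    by move=> z _; exact: cG.
  by apply: le_measure; rewrite ?inE//; exact: measurableI.
have GS : cost_gap p x1 x2 S < c by apply: le_lt_trans c0c; exact: slice.
have rep := cell_map_represents p0 mO muO muc'.
set lambda := fine _ in rep.
have oG : open [set z | c < cost_gap p x1 x2 z].
  rewrite (_ : [set _ | _] = cost_gap p x1 x2 @^-1` [set y | c < y])//.
  by apply: open_comp; [move=> w _; exact: cG|exact: open_gt].
have oL : open [set z | cost_gap p x1 x2 z < c].
  rewrite (_ : [set _ | _] = cost_gap p x1 x2 @^-1` [set y | y < c])//.
  by apply: open_comp; [move=> w _; exact: cG|exact: open_lt].
exists lambda; split.
  case: rep => _ _ _; rewrite cellE cell_swapE !subr0 => l1 l2.
  rewrite -lte_fin -l1 (normalized_lebesgue_open_gt0 cO vO r0 qO oG OP GP)/=.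
  rewrite -subr_gt0 -lte_fin -l2.
  exact: (normalized_lebesgue_open_gt0 cO vO r0 qO oL OS GS).
split.
  exists (cell_map p x1 x2 c), 0, c; split; last exact: rep.
  exact: (cell_map_optimal c p0 mO muO x12).
(* The cell given by [b1] and [b2] has mass [lambda], like the superlevel set at [c], which forces
   [b2 - b1 = c]. *)
move=> T b1 b2 _ [_ _ _ + _]; rewrite cellE.
case: rep => _ _ _ + _; rewrite cellE subr0 => <- E.
have <- := normalized_lebesgue_superlevel_inj vO r0 qO cG OS OP GS GP (esym E).
apply: (@disconnected_by_level _ _ _ (fun z : 'rV[R]_n => z ord0 i) m P Q cc
  (conj OP GP) (conj OQ GQ) Pm mQ).
move=> z [Oz /= h]; apply/eqP => zm.
by have := slice _ Oz zm; rewrite leNgt (lt_trans c0c h).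
Qed.

(** * Inequalities between real powers *)

Lemma powR_expr2 (R : realType) (x q : R) :
  0 <= x -> (x ^+ 2) `^ q = x `^ (2 * q).
Proof. by move=> x0; rewrite powRrM powR_mulrn. Qed.

Lemma ltr_powR_root (R : realType) (x y q : R) :
  0 < q -> 0 <= x -> 0 <= y -> x < y `^ q^-1 -> x `^ q < y.
Proof.
move=> q0 x0 y0 xy.
have -> : y = (y `^ q^-1) `^ q by rewrite -powRrM mulVf ?powRr1 ?gt_eqF.
by apply: gt0_ltr_powR => //; rewrite nnegrE ?powR_ge0.
Qed.

(** Write [(x + a)^p] as [(x + a) * (x + a)^(p - 1)] and bound the last factor below by
    [x^(p - 1)]. *)
Lemma powR_gap_ge (R : realType) (x a p : R) :
  1 < p -> 0 < x -> 0 <= a -> a * x `^ (p - 1) <= (x + a) `^ p - x `^ p.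
Proof.
move=> p1 x0 a0; have p0 : 0 < p by rewrite (lt_trans _ p1).
have xa0 : 0 <= x + a by rewrite addr_ge0// ltW.
rewrite lerBrDr -(mulr_powRB1 xa0 p0) -(mulr_powRB1 (ltW x0) p0) -mulrDl addrC.
rewrite ler_wpM2l// ge0_ler_powR ?nnegrE ?subr_ge0 ?(ltW x0) ?(ltW p1)//.
by rewrite lerDl.
Qed.

Lemma gt1_ltr_powR (R : realType) (x r : R) : 1 < x -> 1 < r -> x < x `^ r.
Proof.
move=> x1 r1; have x0 : 0 < x by rewrite (lt_trans _ x1).
rewrite -(mulr_powRB1 (ltW x0) (lt_trans ltr01 r1)) ltr_pMr//.
have {1}<- : 1 `^ (r - 1) = 1 :> R by rewrite powR1.
by rewrite gt0_ltr_powR ?subr_gt0// nnegrE ltW.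
Qed.

(* For [x1 = 0] and [x2 = (- a, 1)], the last two lines compare p * G on the
   slice [z_0 = m] of a thin box (bounded above) with its value at [(t, 0)].
   The witnesses are [a = 0], [-1, 0, 1] for [p > 2] and small [a], [0, 1, L]
   with large [L] for [p < 2]. *)
Lemma axis_gap_separated (R : realType) (p : R) : 1 < p -> p <> 2 ->
  exists a d tP m tQ : R, [/\ 0 <= a, 0 < d, tP < m, m < tQ &
    forall t, t = tP \/ t = tQ ->
    ((m + a) ^+ 2 + 1 + d) `^ (p / 2) - (m ^+ 2) `^ (p / 2) <
    ((t + a) ^+ 2 + 1) `^ (p / 2) - (t ^+ 2) `^ (p / 2)].
Proof.
move=> p1 p2; have p0 : 0 < p by rewrite (lt_trans _ p1).
have q0 : 0 < p / 2 by rewrite divr_gt0.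
have one r : 1 = 1 `^ r :> R by rewrite powR1.
have [pgt2|pn2] := ltP 2 p.
  have B1 : 1 < 2 `^ (p / 2) - 1 :> R.
    have : 2 < 2 `^ (p / 2) :> R.
      by apply: gt1_ltr_powR; rewrite ?ltr1n// ltr_pdivlMr// mul1r.
    by set b := _ `^ _; lra.
  (* For [a = m = 0] and [t^2 = 1] the claim reads [(1 + d)^(p/2) < 2^(p/2) - 1]. By [B1] this
     leaves room for a positive [d], and half of that room is taken. *)
  pose d := ((2 `^ (p / 2) - 1) `^ (p / 2)^-1 - 1) / 2.
  have d0 : 0 < d.
    rewrite divr_gt0// subr_gt0 [ltLHS](one (p / 2)^-1).
    by apply: gt0_ltr_powR; rewrite ?invr_gt0// nnegrE ?ltW// (lt_trans _ B1).
  exists 0, d, (-1), 0, 1; split;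
    [exact: lexx|exact: d0|exact: ltrN10|exact: ltr01|].
  move=> t tE; rewrite !addr0 expr0n/= powR0 ?gt_eqF// subr0 add0r.
  have -> : t ^+ 2 = 1 by case: tE => ->; rewrite ?sqrrN expr1n.
  rewrite powR1; apply: ltr_powR_root => //.
  - by rewrite addr_ge0 ?(ltW d0).
  - by apply: le_trans (ltW B1).
  - by move: d0; rewrite /d; set b := _ `^ _^-1; lra.
have {p2} p2 : p < 2 by rewrite lt_neqAle pn2 andbT; apply/eqP.
have B2 : 2 < 2 `^ (p / 2)^-1 :> R.
  by apply: gt1_ltr_powR; rewrite ?ltr1n// invf_gt1// ltr_pdivrMr// mul1r.
(* With [d = a] and [m = 1], the slice value is below 1 once [(1 + a)^2 + 1 + a < 2^(2/p)]. As
   [a <= 1/2], the left side is at most [2 + 7a/2], which is less than [2 + 8a]. *)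
pose a := Num.min (2^-1) ((2 `^ (p / 2)^-1 - 2) / 8).
have a0 : 0 < a by rewrite lt_min invr_gt0 ltr0n/= divr_gt0// subr_gt0.
have a12 : a <= 2^-1 by rewrite ge_min lexx.
have aB : a <= (2 `^ (p / 2)^-1 - 2) / 8 by rewrite ge_min lexx orbT.
(* Chosen so that [a * L^(p - 1) = 1]: the lower bound of [powR_gap_ge] at [L] is then exactly 1. *)
pose L := a^-1 `^ (p - 1)^-1.
have p10 : 0 < p - 1 by rewrite subr_gt0.
have L1 : 1 < L.
  rewrite [ltLHS](one (p - 1)^-1).
  apply: gt0_ltr_powR; rewrite ?invr_gt0// ?nnegrE ?invr_ge0 ?(ltW a0)//.
  by rewrite invf_gt1//; lra.
have L0 : 0 < L by rewrite (lt_trans _ L1).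
have c1 : ((1 + a) ^+ 2 + 1 + a) `^ (p / 2) - (1 ^+ 2) `^ (p / 2) < 1.
  rewrite expr1n powR1 ltrBlDr; apply: ltr_powR_root => //.
    by rewrite !addr_ge0 ?sqr_ge0 ?(ltW a0).
  by move: a0 a12 aB B2; set b := _ `^ _^-1; nra.
exists a, a, 0, 1, L; split => //; first exact: ltW.
(* Both witnesses reach at least 1: at [t = 0] because [a^2 + 1 >= 1], at [t = L] by the choice of
   [L]. *)
move=> t [] ->; apply: lt_le_trans c1 _.
  rewrite expr0n/= powR0 ?gt_eqF// subr0 add0r [leLHS](one (p / 2)).
  apply: ge0_ler_powR; rewrite ?nnegrE ?addr_ge0 ?sqr_ge0 ?(ltW q0)//.
  by rewrite lerDr sqr_ge0.
apply: (@le_trans _ _ ((L + a) `^ p - L `^ p)).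
  apply: le_trans (powR_gap_ge p1 L0 (ltW a0)).
  by rewrite /L -powRrM mulVf ?gt_eqF// powRr1 ?invr_ge0 ?divff ?gt_eqF// ltW.
rewrite (powR_expr2 _ (ltW L0)) mulrCA divff// mulr1 lerD2r.
have -> : (L + a) `^ p = ((L + a) ^+ 2) `^ (p / 2).
  by rewrite powR_expr2 ?addr_ge0 ?(ltW L0) ?(ltW a0)// mulrCA divff// mulr1.
by apply: ge0_ler_powR; rewrite ?nnegrE ?addr_ge0 ?sqr_ge0 ?(ltW q0)// lerDl.
Qed.

(** * The thin box and the cost on it *)

Definition by_coord {A : Type} (a b c : A) (i : nat) : A :=
  match i with 0 => a | 1 => b | _ => c end.

(** Coordinate 0 runs along the line through [x1], coordinate 1 goes from [x1] to the height of
    [x2], and all the others are confined to a width governed by [e]. *)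
Definition slab (R : realType) k (L e : R) : set 'rV[R]_k.+2 :=
  [set z | forall i : 'I_k.+2, z ord0 i \in
     `[by_coord (- L) 0 (- e) i, by_coord L 1 e i]].

Definition planar (R : realType) k (a b : R) : 'rV[R]_k.+2 :=
  \row_i by_coord a b 0 i.

Definition rest_sqr (R : realType) k (z : 'rV[R]_k.+2) : R :=
  \sum_(i < k) z ord0 (lift ord0 (lift ord0 i)) ^+ 2.

Lemma slab_compact (R : realType) k (L e : R) : compact (@slab R k L e).
Proof.
apply: (@rV_compact R k.+2 (fun i =>
  `[by_coord (- L) 0 (- e) i, by_coord L 1 e i]%classic)).
by move=> i; exact: segment_compact.
Qed.

Lemma slab_convex (R : realType) k (L e : R) : convex_set (@slab R k L e).
Proof.
move=> x y t; rewrite !inE => Ox Oy i; rewrite !mxE.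
have := Ox i; have := Oy i; rewrite !in_itv/= => /andP[y1 y2] /andP[x1 x2].
have t0 : 0 <= t%:num by [].
have t1 : t%:num <= 1 by [].
move: (by_coord _ _ _ _) (by_coord _ _ _ _) x1 x2 y1 y2 => l h x1 x2 y1 y2.
rewrite /unstable.onem; move: (t%:num) t0 t1 => s s0 s1; nra.
Qed.

Lemma slab_planar (R : realType) k (L e a b : R) :
  0 <= e -> `|a| <= L -> 0 <= b <= 1 -> slab L e (planar k a b).
Proof.
move=> e0 aL b01 [[|[|i]] ik]; rewrite mxE/= in_itv/= ?b01//.
  by rewrite -ler_norml.
by rewrite oppr_le0 e0.
Qed.

Lemma slab_ball (R : realType) k (L e : R) :
  ball (planar k 0 2^-1) (Num.min L (Num.min e 2^-1)) `<=` slab L e.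
Proof.
move=> z [_ h] i; have := h ord0 i.
rewrite /ball/= mxE !lt_min !ltr_distlC in_itv/=.
case: i => [[|[|i]] ik] /= /and3P[/andP[? ?] /andP[? ?] /andP[? ?]];
  apply/andP; split; apply: ltW; lra.
Qed.

Lemma slab_rest_le (R : realType) k (L e : R) (z : 'rV[R]_k.+2) :
  0 <= e -> slab L e z -> rest_sqr z <= e ^+ 2 * k%:R.
Proof.
move=> e0 Oz; rewrite mulr_natr -[in leRHS](card_ord k) -sumr_const.
apply: ler_sum => i _; have := Oz (lift ord0 (lift ord0 i)).
rewrite in_itv/= -ler_norml => h.
by rewrite -real_normK ?num_real// lerXn2r ?nnegrE.
Qed.

Lemma cost_planarE (R : realType) k (p a b : R) (z : 'rV[R]_k.+2) :
  cost p (planar k a b) z = p^-1 *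
  ((z ord0 ord0 - a) ^+ 2 + (z ord0 (lift ord0 ord0) - b) ^+ 2 + rest_sqr z)
    `^ (p / 2).
Proof.
rewrite costC /cost /enorm; congr (_ * _).
set S := \sum_(i < _) _.
have S0 : 0 <= S by apply: sumr_ge0 => i _; exact: sqr_ge0.
rewrite -(powR12_sqrt S0) -powRrM mulrC; congr (_ `^ _).
rewrite /S !big_ord_recl !mxE addrA; congr (_ + _).
by apply: eq_bigr => i _; rewrite !mxE/= subr0.
Qed.

Lemma cost_gap_planarE (R : realType) k (p a : R) (z : 'rV[R]_k.+2) :
  cost_gap p (planar k 0 0) (planar k (- a) 1) z = p^-1 *
  (((z ord0 ord0 + a) ^+ 2 + (z ord0 (lift ord0 ord0) - 1) ^+ 2 + rest_sqr z)
     `^ (p / 2) -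
   (z ord0 ord0 ^+ 2 + z ord0 (lift ord0 ord0) ^+ 2 + rest_sqr z) `^ (p / 2)).
Proof. by rewrite /cost_gap !cost_planarE opprK !subr0 -mulrBr. Qed.

Lemma rest_sqr_planar (R : realType) k (a b : R) : rest_sqr (planar k a b) = 0.
Proof. by apply: big1 => i _; rewrite mxE/= expr0n. Qed.

Lemma rest_sqr_ge0 (R : realType) k (z : 'rV[R]_k.+2) : 0 <= rest_sqr z.
Proof. by apply: sumr_ge0 => i _; exact: sqr_ge0. Qed.

(** * Choice of the box and conclusion *)

Theorem theorem1 (R : realType) (n : nat) (p : R)
    (hn : (2 <= n)%N) (hp : 1 < p) (hp2 : p <> 2) :
  exists (Omega : set 'rV[R]_n) (cOmega : compact Omega)
         (x1 x2 : 'rV[R]_n) (lambda : R),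
    [/\ convex_set Omega,
        (0 < lebesgue_rV n Omega)%E,
        Omega x1, Omega x2 & x1 <> x2] /\
    0 < lambda < 1 /\
    let mu := normalized_lebesgue cOmega in
    let nu := two_diracs lambda x1 x2 in
    (exists T b1 b2, optimal_map p Omega mu nu T /\
       represents p Omega mu lambda x1 x2 T b1 b2) /\
    (forall T b1 b2, optimal_map p Omega mu nu T ->
       represents p Omega mu lambda x1 x2 T b1 b2 ->
       ~ connected (cell p Omega x1 x2 b1 b2)).
Proof.
case: n hn => [//|[//|k]] _.
have [a [d [tP [m [tQ [a0 d0 Pm mQ gap]]]]]] := axis_gap_separated hp hp2.
have p0 : 0 < p := lt_trans ltr01 hp.
have q0 : 0 <= p / 2 by rewrite divr_ge0 ?ltW.
(* Long enough for [x2] and both witnesses; the 1 keeps it positive. *)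
pose L := `|a| + `|tP| + `|tQ| + 1.
have L0 : 0 < L by rewrite ltr_wpDl ?addr_ge0.
have aL : `|a| <= L by rewrite /L -!addrA lerDl !addr_ge0.
have PL : `|tP| <= L.
  by rewrite /L; move: (normr_ge0 a) (normr_ge0 tP) (normr_ge0 tQ); lra.
have QL : `|tQ| <= L.
  by rewrite /L; move: (normr_ge0 a) (normr_ge0 tP) (normr_ge0 tQ); lra.
(* Since [e <= 1], the remaining coordinates add at most [e^2 * k <= e * (k + 1) <= d] to a squared
   distance; [k.+1] keeps the quotient meaningful when [k = 0]. *)
pose e := Num.min 1 (d / k.+1%:R).
have e0 : 0 < e by rewrite lt_min ltr01 divr_gt0.
have e1 : e <= 1 by rewrite ge_min lexx.
have ed : e ^+ 2 * k%:R <= d.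
  apply: (@le_trans _ _ (e * k.+1%:R)).
    rewrite expr2 -mulrA ler_pM2l// -[leRHS]mul1r.
    by apply: ler_pM => //; [exact: ltW|rewrite ler_nat].
  by rewrite -ler_pdivlMr// ge_min lexx orbT.
have r0 : 0 < Num.min L (Num.min e 2^-1).
  by rewrite lt_min L0 lt_min e0 invr_gt0/=.
pose x1 := planar k (0 : R) 0; pose x2 := planar k (- a) 1.
have x12 : x1 <> x2.
  move/rowP/(_ (lift ord0 ord0)); rewrite !mxE/= => /esym/eqP.
  by rewrite oner_eq0.
have b0 : 0 <= (0 : R) <= 1 by rewrite lexx ler01.
have b1 : 0 <= (1 : R) <= 1 by rewrite lexx ler01.
have Ox t : `|t| <= L -> slab L e (planar k t 0).
  by move=> tL; apply: slab_planar => //; exact: ltW.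
have O1 : slab L e x1 by apply: Ox; rewrite normr0; exact: ltW.
have O2 : slab L e x2 by apply: slab_planar; rewrite ?normrN//; exact: ltW.
pose c0 := p^-1 * (((m + a) ^+ 2 + 1 + d) `^ (p / 2) - (m ^+ 2) `^ (p / 2)).
have gapE t : cost_gap p x1 x2 (planar k t 0) =
    p^-1 * (((t + a) ^+ 2 + 1) `^ (p / 2) - (t ^+ 2) `^ (p / 2)).
  rewrite cost_gap_planarE rest_sqr_planar !mxE/= sub0r sqrrN expr1n.
  by rewrite expr0n/= !addr0.
have c0E t : t = tP \/ t = tQ -> c0 < cost_gap p x1 x2 (planar k t 0).
  by move=> tE; rewrite gapE ltr_pM2l ?invr_gt0//; exact: gap.
(* The two powers are bounded separately: the first base is largest for [(y - 1)^2 = 1] and rest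
   [d], the second smallest for [y = 0] and rest 0. *)
have slice z : slab L e z -> z ord0 ord0 = m -> cost_gap p x1 x2 z <= c0.
  move=> Oz zm; rewrite cost_gap_planarE zm ler_pM2l ?invr_gt0//.
  have := le_trans (slab_rest_le (ltW e0) Oz) ed.
  move: (rest_sqr_ge0 z) => s0 sd.
  have := Oz (lift ord0 ord0); rewrite in_itv/= => /andP[y0 y1].
  have := sqr_ge0 m; have := sqr_ge0 (m + a).
  move: (rest_sqr z) (z _ _) s0 sd y0 y1 => s y s0 sd y0 y1 A0 B0.
  have Y1 : (y - 1) ^+ 2 <= 1 by nra.
  move: (sqr_ge0 y) (sqr_ge0 (y - 1)) Y1 A0 B0 => {y0 y1}.
  move: ((y - 1) ^+ 2) (y ^+ 2) ((m + a) ^+ 2) (m ^+ 2) => A B C D.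
  move=> B0 A0 A1 D0 C0; clear -q0 B0 A0 A1 D0 C0 s0 sd d0.
  by apply: lerB; apply: ge0_ler_powR => //; rewrite ?nnegrE; lra.
have cO := @slab_compact R k L e.
have vO := @slab_convex R k L e.
have bO := @slab_ball R k L e.
have Pi : planar k tP 0 ord0 ord0 < m by rewrite mxE.
have Qi : m < planar k tQ 0 ord0 ord0 by rewrite mxE.
have [lambda H] := disconnected_cell cO p0 vO r0 bO x12 (Ox _ PL) (Ox _ QL)
  Pi Qi (c0E _ (or_introl erefl)) (c0E _ (or_intror erefl)) slice.
exists (slab L e), cO, x1, x2, lambda; split; last exact: H.
by split => //; exact: (convex_lebesgue_rV_gt0 cO vO r0 bO).
Qed.
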